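(* For all real $a,b,c>0$, $$J_{(9,0,0)}(a,b,c)+J_{(3,3,3)}(a,b,c)\ge 2J_{(7,1,1)}(a,b,c).$$
   Context: For a triple $\eta=(\eta_1,\eta_2,\eta_3)$ of nonnegative integers, the labeled orbit sum is $J_\eta(x_1,x_2,x_3)=\sum_{\sigma\in S_3}\prod_{i=1}^3 x_i^{\eta_{\sigma(i)}}$, where all six permutations are counted, also when exponents repeat. *)

(* Defs.v *)
From HB Require Import structures.
From mathcomp Require Import all_boot all_order all_algebra all_fingroup.
Import GRing.Theory.

Set Implicit Arguments.
Unset Strict Implicit.
Unset Printing Implicit Defensive.

Local Open Scope ring_scope.

(* The sum ranges over all six permutations of the positions, so repeated
   exponents give repeated terms. *)
Definition J (R : comPzSemiRingType) (eta : 3.-tuple nat) (x1 x2 x3 : R) : R :=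
  \sum_(s : 'S_3) \prod_(i < 3) tnth [tuple x1; x2; x3] i ^+ tnth eta (s i).

(* Main.v *)
(** The inequality reads
      2 abc (a^6 + b^6 + c^6) <= a^9 + b^9 + c^9 + 3 (abc)^3.
    By symmetry c <= b <= a; after substituting b = c + u and a = c + u + v,
    the difference of the two sides is a polynomial in c, u, v all of whose
    coefficients are nonnegative. *)
Require Import Defs.
From HB Require Import structures.
From mathcomp Require Import all_boot all_order all_algebra all_fingroup.
From mathcomp Require Import reals.
From mathcomp Require Import ring.
Import Order.TTheory GRing.Theory Num.Theory.
Local Open Scope ring_scope.

(** [J] is the permanent of the matrix of powers [x_i ^+ eta_j], so its six terms can be obtained by
    row expansion instead of enumerating ['S_3]. *)
Definition permanent (R : comPzSemiRingType) (n : nat)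
    (A : 'I_n -> 'I_n -> R) : R :=
  \sum_(s : 'S_n) \prod_i A i (s i).

Lemma permanent0 (R : comPzSemiRingType) (A : 'I_0 -> 'I_0 -> R) :
  permanent R 0 A = 1.
Proof.
rewrite /permanent; under eq_bigr do rewrite big_ord0.
by rewrite sumr_const card_Sn.
Qed.

(** The value at [i] recovers [k], and the values at the other points then recover [s]. Injectivity
    suffices because [n.+1 * n]! is the factorial of [n.+1]. *)
Lemma lift_perm_bij (n : nat) (i : 'I_n.+1) :
  bijective (fun p : 'I_n.+1 * 'S_n => lift_perm i p.1 p.2).
Proof.
apply: inj_card_bij; last by rewrite card_prod card_ord !card_Sn factS.
move=> [k s] [l r] /= eq_ks.
have eq_kl : k = l by rewrite -(lift_perm_id i k s) eq_ks lift_perm_id.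
congr (_, _) => //; apply/permP => j; apply: (@lift_inj _ k).
by rewrite -(lift_perm_lift i) eq_ks lift_perm_lift eq_kl.
Qed.

(** Laplace expansion without signs: permutations are grouped by the image [k] of [ord0]. *)
Lemma permanent_expand_row0 (R : comPzSemiRingType) (n : nat)
    (A : 'I_n.+1 -> 'I_n.+1 -> R) :
  permanent R n.+1 A =
  \sum_k A ord0 k * permanent R n (fun i j => A (lift ord0 i) (lift k j)).
Proof.
rewrite /permanent (reindex _ (onW_bij _ (lift_perm_bij n ord0))) /=.
under [RHS]eq_bigr do rewrite big_distrr /=.
rewrite pair_bigA; apply: eq_bigr => -[k s] _ /=.
rewrite big_ord_recl lift_perm_id; congr (_ * _).
by apply: eq_bigr => i _; rewrite lift_perm_lift.
Qed.

Lemma J_expand (R : comPzSemiRingType) (k l m : nat) (x y z : R) :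
  J [tuple k; l; m] x y z =
    x ^+ k * (y ^+ l * z ^+ m + y ^+ m * z ^+ l) +
    x ^+ l * (y ^+ k * z ^+ m + y ^+ m * z ^+ k) +
    x ^+ m * (y ^+ k * z ^+ l + y ^+ l * z ^+ k).
Proof.
transitivity (permanent R 3
  (fun i j => tnth [tuple x; y; z] i ^+ tnth [tuple k; l; m] j)) => //.
do 3! rewrite ?permanent_expand_row0 ?permanent0 !big_ord_recl ?big_ord0 /=.
(* The default [0%N] serves the exponent tuple and [0] the tuple of variables; as [nth], the entries
   at lifted indices compute. *)
rewrite !permanent0 !(tnth_nth 0%N) !(tnth_nth 0) /=.
by rewrite !(mulr1, addr0) !addrA.
Qed.

Ltac nonneg :=
  lazymatch goal with
  | |- is_true (0 <= _ + _) => apply: addr_ge0; nonneg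
  | |- is_true (0 <= _ * _) => apply: mulr_ge0; nonneg
  | |- is_true (0 <= _ ^+ _) => apply: exprn_ge0; nonneg
  | |- is_true (0 <= _%:R) => exact: ler0n
  | |- _ => assumption
  end.

Lemma degree9_ineq_sorted (R : realDomainType) (a b c : R) :
  0 <= c -> c <= b -> b <= a ->
  2 * (a * b * c * (a ^+ 6 + b ^+ 6 + c ^+ 6)) <=
  a ^+ 9 + b ^+ 9 + c ^+ 9 + 3 * (a * b * c) ^+ 3.
Proof.
move=> c_ge0 le_cb le_ba.
have [u u_ge0 def_b] : exists2 u, 0 <= u & b = c + u.
  by exists (b - c); rewrite ?subr_ge0 // addrC subrK.
have [v v_ge0 def_a] : exists2 v, 0 <= v & a = c + u + v.
  by exists (a - b); rewrite ?subr_ge0 // -def_b addrC subrK.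
rewrite -subr_ge0 {}def_a {}def_b.
(* Sorted by powers of [c]. Equality at [a = b = c] kills [c ^+ 9]; the gradient also vanishes
   there, by symmetry and homogeneity, which kills [c ^+ 8]. The part free of [c] is
   [(u + v) ^+ 9 + u ^+ 9]. *)
have -> : (c + u + v) ^+ 9 + (c + u) ^+ 9 + c ^+ 9
    + 3 * ((c + u + v) * (c + u) * c) ^+ 3
    - 2 * ((c + u + v) * (c + u) * c
           * ((c + u + v) ^+ 6 + (c + u) ^+ 6 + c ^+ 6)) =
    (3 * u ^+ 2 + 3 * u * v + 3 * v ^+ 2) * c ^+ 7 +
    (4 * u ^+ 3 + 6 * u ^+ 2 * v + 36 * u * v ^+ 2 + 17 * v ^+ 3) * c ^+ 6 +
    (17 * u ^+ 4 + 34 * u ^+ 3 * v + 180 * u ^+ 2 * v ^+ 2 +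
      163 * u * v ^+ 3 + 56 * v ^+ 4) * c ^+ 5 +
    (46 * u ^+ 5 + 115 * u ^+ 4 * v + 456 * u ^+ 3 * v ^+ 2 +
      569 * u ^+ 2 * v ^+ 3 + 350 * u * v ^+ 4 + 84 * v ^+ 5) * c ^+ 4 +
    (59 * u ^+ 6 + 177 * u ^+ 5 * v + 639 * u ^+ 4 * v ^+ 2 +
      983 * u ^+ 3 * v ^+ 3 + 840 * u ^+ 2 * v ^+ 4 + 378 * u * v ^+ 5 +
      70 * v ^+ 6) * c ^+ 3 +
    (40 * u ^+ 7 + 140 * u ^+ 6 * v + 504 * u ^+ 5 * v ^+ 2 +
      910 * u ^+ 4 * v ^+ 3 + 980 * u ^+ 3 * v ^+ 4 + 630 * u ^+ 2 * v ^+ 5 +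
      224 * u * v ^+ 6 + 34 * v ^+ 7) * c ^+ 2 +
    (14 * u ^+ 8 + 56 * u ^+ 7 * v + 210 * u ^+ 6 * v ^+ 2 +
      434 * u ^+ 5 * v ^+ 3 + 560 * u ^+ 4 * v ^+ 4 + 462 * u ^+ 3 * v ^+ 5 +
      238 * u ^+ 2 * v ^+ 6 + 70 * u * v ^+ 7 + 9 * v ^+ 8) * c +
    (2 * u ^+ 9 + 9 * u ^+ 8 * v + 36 * u ^+ 7 * v ^+ 2 +
      84 * u ^+ 6 * v ^+ 3 + 126 * u ^+ 5 * v ^+ 4 + 126 * u ^+ 4 * v ^+ 5 +
      84 * u ^+ 3 * v ^+ 6 + 36 * u ^+ 2 * v ^+ 7 + 9 * u * v ^+ 8 +
      v ^+ 9) by ring.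
nonneg.
Qed.

Lemma degree9_ineq (R : realDomainType) (a b c : R) :
  0 <= a -> 0 <= b -> 0 <= c ->
  2 * (a * b * c * (a ^+ 6 + b ^+ 6 + c ^+ 6)) <=
  a ^+ 9 + b ^+ 9 + c ^+ 9 + 3 * (a * b * c) ^+ 3.
Proof.
wlog le_ba : a b c / b <= a => [IH|] a_ge0 b_ge0 c_ge0.
  case/orP: (le_total b a) => [|le_ab]; first by move=> ?; exact: IH.
  have := IH b a c le_ab b_ge0 a_ge0 c_ge0.
  by rewrite (mulrC b) [b ^+ 6 + _]addrC [b ^+ 9 + _]addrC.
(* With [b <= a] fixed, [c] lies below [b], between [b] and [a], or above [a]. The rewrites undo the
   reordering of the variables. *)
have [le_cb|/ltW le_bc] := leP c b; first exact: degree9_ineq_sorted.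
have [le_ca|/ltW le_ac] := leP c a.
  have := degree9_ineq_sorted _ a c b b_ge0 le_bc le_ca.
  by rewrite (mulrAC a) (addrAC (a ^+ 6)) (addrAC (a ^+ 9)).
have := degree9_ineq_sorted _ c a b b_ge0 le_ba le_ac.
by rewrite (mulrC c) (mulrAC a) [c ^+ 6 + _]addrC [c ^+ 9 + _]addrC
  (addrAC (a ^+ 6)) (addrAC (a ^+ 9)).
Qed.

Theorem theorem2p3 (R : realType) (a b c : R)
  (ha : 0 < a) (hb : 0 < b) (hc : 0 < c) :
  J [tuple 9%N; 0%N; 0%N] a b c + J [tuple 3%N; 3%N; 3%N] a b c
    >= 2 * J [tuple 7%N; 1%N; 1%N] a b c.
Proof.
have := degree9_ineq _ a b c (ltW ha) (ltW hb) (ltW hc).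
(* Each monomial of [degree9_ineq] occurs in the orbit sums with twice its coefficient, since
   repeated exponents are counted repeatedly; hence the factor 2. *)
rewrite -(ler_pM2l (ltr0Sn _ 1)) !J_expand.
by congr (_ <= _); ring.
Qed.
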